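(* For every $n\ge 3$, every optimal matching preclusion set of the $n$-dimensional bubble-sort star graph $BS_n$ is trivial.
   Context: For a permutation $v=v_1v_2\cdots v_n$ of $[1,n]$ and distinct $i,j$, $v\circ\langle i,j\rangle$ denotes the permutation obtained from $v$ by exchanging the entries in positions $i$ and $j$. The bubble-sort star graph $BS_n$ has as vertex set all permutations of $[1,n]$, and distinct $u,v$ are adjacent iff $u=v\circ\langle 1,i\rangle$ for some $i\in[2,n]$ or $u=v\circ\langle i-1,i\rangle$ for some $i\in[3,n]$. A perfect matching covers every vertex; an almost-perfect matching covers all vertices but one. The matching preclusion number $\mathrm{mp}(G)$ is the minimum size of an edge set $F\subseteq E(G)$ such that $G-F$ has neither a perfect matching nor an almost-perfect matching; such an $F$ of size $\mathrm{mp}(G)$ is an optimal matching preclusion set. An optimal matching preclusion set is trivial if all its edges are incident with one common vertex. *)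

(* Defs.v *)
From mathcomp Require Import all_boot all_fingroup.

Set Implicit Arguments.
Unset Strict Implicit.
Unset Printing Implicit Defensive.

Section MatchingPreclusion.

(* A simple graph on T is a symmetric irreflexive relation e; an edge is a
   two-element set of vertices. *)
Variables (T : finType) (e : rel T).

Definition edges : {set {set T}} :=
  [set [set x; y] | x in T, y in T & e x y].

Definition matching (E M : {set {set T}}) : bool :=
  (M \subset E) && trivIset M.

Definition perfect_matching (E M : {set {set T}}) : bool :=
  matching E M && (cover M == [set: T]).

Definition almost_perfect_matching (E M : {set {set T}}) : bool :=
  matching E M && (#|~: cover M| == 1).

Definition preclusion_set (F : {set {set T}}) : bool :=
  (F \subset edges) &&
  ~~ [exists M, perfect_matching (edges :\: F) M
             || almost_perfect_matching (edges :\: F) M].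

(* As soon as T has two vertices, [edges] is itself a preclusion set, so the
   default value of the arg min is irrelevant. *)
Definition mp : nat :=
  #|[arg min_(F < edges | preclusion_set F) #|F|]|.

Definition optimal_preclusion_set (F : {set {set T}}) : bool :=
  preclusion_set F && (#|F| == mp).

End MatchingPreclusion.

Definition trivial_edge_set (T : finType) (F : {set {set T}}) : bool :=
  [exists x, forall f in F, x \in f].

(* Positions and values are numbered 0, ..., n-1 instead of 1, ..., n.  Since
   (s * t) k = t (s k) in 'S_n, the product below first permutes positions:
   it is v with the entries in positions i and j exchanged. *)
Definition swap_entries n (v : 'S_n) (i j : 'I_n) : 'S_n := (tperm i j * v)%g.

(* Adjacency in BS_n: exchange of positions 0 and j with 1 <= j, or of
   positions j-1 and j with 2 <= j. *)
Definition bubble_sort_star n : rel 'S_n := fun u v =>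
  [exists i : 'I_n, exists j : 'I_n,
    (((i == 0 :> nat) && (1 <= j)) || ((i.+1 == j :> nat) && (2 <= j)))
    && (u == swap_entries v i j)].

Lemma bubble_sort_star_sym n : symmetric (@bubble_sort_star n).
Proof.
have sub u v : bubble_sort_star u v -> @bubble_sort_star n v u.
  case/existsP=> i /existsP[j /andP[ij /eqP->]].
  apply/existsP; exists i; apply/existsP; exists j.
  by rewrite ij /swap_entries mulgA tperm2 mul1g eqxx.
by move=> u v; apply/idP/idP; apply: sub.
Qed.

Lemma bubble_sort_star_irrefl n : irreflexive (@bubble_sort_star n).
Proof.
move=> u; apply/negbTE/negP.
case/existsP=> i /existsP[j /andP[ij /eqP eq_u]].
have := congr1 (fun s : 'S_n => s i) eq_u.
rewrite permM tpermL => /perm_inj eq_ij; move: ij; rewrite eq_ij.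
by case/orP=> /andP[/eqP]; [move=> -> | move/eqP; rewrite eqn_leq ltnn].
Qed.

Lemma preclusion_set_edges (T : finType) (e : rel T) :
  1 < #|T| -> preclusion_set e (edges e).
Proof.
move=> T_gt1; rewrite /preclusion_set subxx setDv; apply/existsPn=> M.
rewrite /perfect_matching /almost_perfect_matching /matching subset0.
have [->|//] := eqVneq M set0; rewrite /cover big_set0 setC0 cardsT.
rewrite (gtn_eqF T_gt1) andbF orbF negb_and; apply/orP; right.
by apply: contraTneq T_gt1 => T0; rewrite -cardsT -T0 cards0.
Qed.

(* Main.v *)
Require Import Defs.
From mathcomp Require Import all_boot all_fingroup.

Set Implicit Arguments.
Unset Strict Implicit.
Unset Printing Implicit Defensive.

Import GroupScope.

(* BS_n is the Cayley graph of 'S_n for a set G of transpositions, so each t in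
   G is the colour of a perfect matching x -> t * x.  Removing the edges at one
   vertex shows mp <= #|G|, hence an optimal F consists of exactly one edge of
   each colour t, with an even end p t and an odd end t * p t.  Recolouring the
   matching of t by u inside one coset of <t, u> must again meet F, so the edges
   of colours t and u lie in the same coset.  If t and u commute this coset is a
   4-cycle and the two edges share an end.  If t, u and t * u * t are all in G,
   it is a K_(3,3), whose three other perfect matchings must be met as well;
   again the edges share an end.  Edges of a bipartite graph that pairwise share
   ends form a star, and the triangles {0, j-1, j}, {0, j, j+1} of the fan of
   generators have the same star centre since (0 j-1) and (j j+1) commute. *)

(** * Preclusion sets in a general graph *)

Section PreclusionSets.

Variables (T : finType) (e : rel T).

Lemma mem_edges x y : e x y -> [set x; y] \in edges e.
Proof.
by move=> exy; apply/imset2P; apply: (Imset2spec (x1 := x) (x2 := y)); rewrite ?inE.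
Qed.

Lemma optimal_preclusion_set_min (F F' : {set {set T}}) :
  1 < #|T| -> optimal_preclusion_set e F -> preclusion_set e F' ->
  #|F| <= #|F'|.
Proof.
move=> T_gt1 /andP[_ /eqP->] prF'; rewrite /mp.
by case: arg_minnP => [|E _]; [apply: preclusion_set_edges | apply].
Qed.

(** The orbits of [f] are the edges of a perfect matching, which must lose one of them. *)
Lemma preclusion_set_meets_involution (F : {set {set T}}) (f : T -> T) :
  preclusion_set e F -> involutive f -> (forall x, e x (f x)) ->
  exists x, [set x; f x] \in F.
Proof.
move=> /andP[_ /existsPn noM] fK ef; apply/existsP/existsPn => F'f.
pose M := [set [set x; f x] | x in T].
have /norP[/negP[]] := noM M.
apply/andP; split; last first.
  rewrite eqEsubset subsetT; apply/subsetP=> x _; apply/bigcupP.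
  by exists [set x; f x]; rewrite ?set21 //; apply: imset_f.
apply/andP; split.
  apply/subsetP=> _ /imsetP[x _ ->]; rewrite inE F'f /=.
  exact: mem_edges.
apply/trivIsetP=> _ _ /imsetP[x _ ->] /imsetP[y _ ->]; apply: contraR.
case/pred0Pn=> z /andP[] /set2P[] -> /set2P[] => [-> | -> | <- | /(can_inj fK) ->];
  rewrite ?fK // setUC //.
Qed.

Lemma card_cover_matching (E M : {set {set T}}) :
  irreflexive e -> E \subset edges e -> matching E M -> #|cover M| = (#|M| * 2)%N.
Proof.
move=> e_irr sE /andP[sM /eqP <-]; rewrite -sum_nat_const; apply: eq_bigr => A MA.
have /imset2P[x y _] := subsetP sE A (subsetP sM A MA).
rewrite inE => /andP[_ exy] ->; rewrite cards2.
by case: eqVneq exy => // ->; rewrite e_irr.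
Qed.

(** Without these edges [x] is isolated, so no perfect matching survives. A matching covers an even
    number of vertices, so even order rules out almost-perfect ones. *)
Lemma preclusion_set_star (x : T) :
  irreflexive e -> symmetric e -> ~~ odd #|T| ->
  preclusion_set e [set [set x; y] | y in e x].
Proof.
move=> e_irr e_sym evenT; apply/andP; split.
  apply/subsetP=> _ /imsetP[y exy ->].
  exact: mem_edges.
apply/existsPn => M; apply/norP; split.
  apply/negP=> /andP[/andP[/subsetP sM _] /eqP covM].
  have: x \in cover M by rewrite covM inE.
  case/bigcupP=> A /sM /setDP[/imset2P[y z _]]; rewrite inE => /andP[_ eyz] ->.
  move=> nF /set2P[] xE; rewrite -xE in eyz nF; case/imsetP: nF.
    by exists z.
  by exists y; [rewrite unfold_in e_sym | rewrite setUC].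
apply/negP=> /andP[mM /eqP cM].
have := cardsC (cover M); rewrite cM (card_cover_matching _ _ mM) ?subsetDl //.
by move=> eqT; move: evenT; rewrite -eqT oddD oddM andbF.
Qed.

End PreclusionSets.

(** In a finite group inverses are powers, so every element of [<<A>>] is a product of elements of
    [A]. *)
Lemma gen_subset_closed (gT : finGroupType) (A E : {set gT}) :
  1 \in E -> (forall a x, a \in A -> x \in E -> a * x \in E) -> <<A>> \subset E.
Proof.
move=> E1 EM; apply/subsetP=> _ /gen_prodgP[m [c Ac ->]].
by elim/big_rec: _ => // i x _; apply: EM.
Qed.

(** * Optimal sets in a Cayley graph of odd involutions *)

Section CayleyPreclusion.

Variables (n : nat) (G : {set 'S_n}) (e : rel 'S_n).
Hypotheses (n_gt1 : 1 < n) (eG : forall u v, e u v = (u * v^-1 \in G)).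
Hypotheses (G_odd : forall t, t \in G -> odd_perm t).
Hypotheses (G_inv : forall t, t \in G -> t * t = 1).

Lemma cayley_invK t : t \in G -> involutive (fun x : 'S_n => t * x).
Proof. by move=> Gt x; rewrite mulgA G_inv ?mul1g. Qed.

(** A generator flips parity, so an edge has one end of each parity and equal edges agree end by
    end. *)
Lemma cayley_eq_edge t u (x y : 'S_n) :
  t \in G -> u \in G -> odd_perm x = odd_perm y ->
  [set x; t * x] = [set y; u * y] -> x = y /\ t = u.
Proof.
move=> Gt Gu xy eqE.
have par z w s : s \in G -> odd_perm z = odd_perm w -> z <> s * w.
  by move=> Gs zw zE; move: zw; rewrite zE odd_permM G_odd //; case: odd_perm.
have eqxy: x = y.
  by have := set21 x (t * x); rewrite eqE => /set2P[] // /par-/(_ Gu xy).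
split=> //; have := set22 x (t * x); rewrite eqE eqxy => /set2P[] => [/esym/par | /mulIg] //.
by case.
Qed.

(** The last clause restates in terms of [p] that [F] meets every perfect matching; together with
    the parity clause it is all that the later lemmas use about [F]. *)
Lemma optimal_cayley_edges (F : {set {set 'S_n}}) :
  optimal_preclusion_set e F ->
  exists p : 'S_n -> 'S_n,
  [/\ forall t, t \in G -> ~~ odd_perm (p t),
      F = [set [set p t; t * p t] | t in G]
    & forall f : 'S_n -> 'S_n, involutive f -> (forall x, f x * x^-1 \in G) ->
      exists2 t, t \in G & f (p t) = t * p t].
Proof.
move=> optF; have /andP[prF _] := optF.
have e_sym: symmetric e.
  have sub u v : e u v -> e v u.
    rewrite !eG => Guv; suff -> : v * u^-1 = u * v^-1 by [].
    by apply: (mulgI (u * v^-1)); rewrite G_inv // -mulgA mulKg mulgV.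
  by move=> u v; apply/idP/idP; apply: sub.
have e_irr: irreflexive e.
  by move=> u; rewrite eG mulgV; apply/negP => /G_odd; rewrite odd_perm1.
have evenS: ~~ odd #|'S_n|.
  by rewrite card_Sn -dvdn2 dvdn_fact // n_gt1.
have S_gt1: 1 < #|'S_n|.
  by rewrite card_Sn; case: n n_gt1 => [|[|m]] // _;
    rewrite factS (leq_trans _ (leq_pmulr _ (fact_gt0 _))).
have leFG: #|F| <= #|G|.
  apply: leq_trans (optimal_preclusion_set_min S_gt1 optF
    (preclusion_set_star 1 e_irr e_sym evenS)) _.
  apply: leq_trans (leq_imset_card _ _) _.
  rewrite subset_leq_card //; apply/subsetP=> y.
  by rewrite unfold_in e_sym eG invg1 mulg1.
(* Outside [G] the value [1] is a filler. *)
have /fin_all_exists[p pP] t : exists p, t \in G ->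
    ~~ odd_perm p /\ [set p; t * p] \in F.
  have [Gt|_] := boolP (t \in G); last by exists 1.
  have [|x Fx] := preclusion_set_meets_involution prF (cayley_invK Gt).
    by move=> x; rewrite e_sym eG /= mulgK.
  have [ox | ex] := boolP (odd_perm x); last by exists x.
  by exists (t * x); rewrite odd_permM G_odd // ox mulgA G_inv // mul1g setUC.
have eqF : F = [set [set p t; t * p t] | t in G].
  apply/esym/eqP; rewrite eqEcard; apply/andP; split.
    by apply/subsetP=> _ /imsetP[t /pP[_ Ft] ->].
  (* Distinct colours give distinct edges, so the image has [#|G|] elements and exhausts [F]. *)
  rewrite card_in_imset // => t u Gt Gu.
  case/cayley_eq_edge => //.
  by rewrite (negbTE (proj1 (pP t Gt))) (negbTE (proj1 (pP u Gu))).
exists p; split=> // [t /pP[] // | f fK Gf].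
have [|x] := preclusion_set_meets_involution prF fK.
  by move=> x; rewrite e_sym eG.
rewrite eqF => /imsetP[t Gt eqE]; exists t => //.
pose s := f x * x^-1; have Gs : s \in G by apply: Gf.
have fxE : f x = s * x by rewrite mulgKV.
(* Either [x] has the parity of [p t] and equals it, or [f x] does and the edge is read from its
   other end. *)
have [px | px] := eqVneq (odd_perm x) (odd_perm (p t)).
  by rewrite fxE in eqE; have [<- <-] := cayley_eq_edge Gs Gt px eqE.
rewrite setUC -{2}[x]fK in eqE.
pose s' := f (f x) * (f x)^-1; have Gs' : s' \in G by apply: Gf.
have ffxE : f (f x) = s' * f x by rewrite mulgKV.
rewrite ffxE in eqE.
have [|<- <-] := cayley_eq_edge Gs' Gt _ eqE; last by [].
by rewrite fxE odd_permM G_odd //; case: odd_perm px; case: odd_perm.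
Qed.

(** * Relative position of two precluded edges *)

Variable p : 'S_n -> 'S_n.
Hypothesis p_even : forall t, t \in G -> ~~ odd_perm (p t).
Hypothesis p_meets : forall f : 'S_n -> 'S_n,
  involutive f -> (forall x, f x * x^-1 \in G) ->
  exists2 t, t \in G & f (p t) = t * p t.

(* The edge of colour [t] joins [p t] to [t * p t]; by parity, two such edges
   can only meet at ends of the same kind. *)
Definition share_end t u := (p t == p u) || (t * p t == u * p u).

(* The matching to consider has colour [u] on the coset of [p t] and colour [t]
   elsewhere. *)
Lemma precluded_edges_same_coset (K : {group 'S_n}) t u :
  t \in G -> u \in G -> t \in K -> u \in K -> p u * (p t)^-1 \in K.
Proof.
move=> Gt Gu Kt Ku.
pose f x := if x * (p t)^-1 \in K then u * x else t * x.
have fK: involutive f.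
  move=> x; rewrite /f; have [Kx|/negbTE Kx] := boolP (x * _ \in K).
    by rewrite -mulgA groupMl // Kx cayley_invK.
  by rewrite -mulgA groupMl // Kx cayley_invK.
have Gf x : f x * x^-1 \in G by rewrite /f; case: ifP; rewrite mulgK.
have [v Gv] := p_meets fK Gf; rewrite /f; case: ifP => Kv /mulIg eqv.
  by rewrite eqv.
(* Outside the coset the matching could only be met in colour [t], but [p t] lies in the coset. *)
by rewrite -eqv mulgV group1 in Kv.
Qed.

Lemma odd_quotient t u :
  t \in G -> u \in G -> odd_perm (p u * (p t)^-1) = false.
Proof.
by move=> Gt Gu; rewrite odd_permM odd_permV (negbTE (p_even Gt)) (negbTE (p_even Gu)).
Qed.

(** The even elements of the coset are [p t] and [t * u * p t]. If [p u] is the first, the even ends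
    agree; if it is the second, the odd ends do. *)
Lemma commuting_share_end t u :
  t \in G -> u \in G -> commute t u -> share_end t u.
Proof.
move=> Gt Gu ctu.
have /subsetP sub: <<[set t; u]>> \subset [set 1; t; u; t * u].
  apply: gen_subset_closed => [|a x /set2P[]->]; first by rewrite !inE eqxx.
    rewrite !inE -!orbA => /or4P[] /eqP->;
    by rewrite ?mulg1 ?mulgA ?G_inv ?mul1g ?eqxx ?orbT.
  rewrite !inE -!orbA => /or4P[] /eqP->;
  by rewrite ?mulg1 ?mulgA -?ctu -?mulgA ?G_inv ?mul1g ?mulg1 ?eqxx ?orbT.
have := sub _ (precluded_edges_same_coset Gt Gu
  (mem_gen (set21 t u)) (mem_gen (set22 t u))).
have := odd_quotient Gt Gu; set h := p u * _.
have pu : p u = h * p t by rewrite mulgKV.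
rewrite /share_end pu !inE -!orbA => oh /or4P[] /eqP hE.
- by rewrite hE mul1g eqxx.
- by rewrite hE G_odd in oh.
- by rewrite hE G_odd in oh.
by rewrite hE ctu mulgA mulgA G_inv // mul1g eqxx orbT.
Qed.

(* On the coset of [p t] the matching is [h * p t -> h * s * p t], and it has
   colour [t] elsewhere. *)
Lemma braid_meets (K : {group 'S_n}) t s :
  t \in G -> t \in K -> s \in K -> s * s = 1 ->
  (forall h, h \in K -> s ^ h \in G) ->
  exists v, [/\ v \in G, p v * (p t)^-1 \in K &
    v = s ^ (p v * (p t)^-1)^-1].
Proof.
move=> Gt Kt Ks ss GsK.
pose f x := if x * (p t)^-1 \in K then x * (p t)^-1 * s * p t else t * x.
have fK: involutive f.
  move=> x; rewrite /f; have [Kx|/negbTE Kx] := boolP (x * _ \in K).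
    by rewrite mulgK groupMr // Kx -[_ * s * s]mulgA ss mulg1 mulgKV.
  by rewrite -mulgA groupMl // Kx cayley_invK.
have Gf x : f x * x^-1 \in G.
  rewrite /f; case: ifP => Kx; last by rewrite mulgK.
  by have := GsK _ (groupVr Kx); rewrite conjgE invgK invMg invgK !mulgA.
have [v Gv] := p_meets fK Gf; rewrite /f; case: ifP => Kv eqv.
  exists v; split=> //; rewrite conjgE invgK invMg invgK !mulgA.
  by rewrite eqv mulgK.
by rewrite -(mulIg _ _ _ eqv) mulgV group1 in Kv.
Qed.

(** Here [t] and [u] generate a copy of the symmetric group on three letters. Of the three even
    positions for [p u], [p t] gives a common even end and [u * t * p t] a common odd end;
    [t * u * p t] has to be excluded. *)
Lemma braid_share_end t u :
  t \in G -> u \in G -> t * u * t \in G -> t * u * t = u * t * u -> t != u ->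
  share_end t u.
Proof.
move=> Gt Gu; set w := t * u * t => Gw braid neq_tu.
have tt := G_inv Gt; have uu := G_inv Gu; have ww := G_inv Gw.
have tV : t^-1 = t by apply/(mulgI t); rewrite mulgV tt.
have uV : u^-1 = u by apply/(mulgI u); rewrite mulgV uu.
have tw : t * w = u * t by rewrite /w !mulgA tt mul1g.
have uw : u * w = t * u by rewrite braid !mulgA uu mul1g.
have wt : w * t = t * u by rewrite /w -!mulgA tt mulg1.
have wu : w * u = u * t by rewrite braid -!mulgA uu mulg1.
have tJt : t ^ t = t by rewrite conjgE tV tt mulg1.
have uJu : u ^ u = u by rewrite conjgE uV uu mulg1.
have tJu : t ^ u = w by rewrite conjgE uV mulgA -braid.
have uJt : u ^ t = w by rewrite conjgE tV mulgA.
have wJt : w ^ t = u by rewrite conjgE tV wt mulgA tt mul1g.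
have wJu : w ^ u = t by rewrite conjgE uV wu mulgA uu mul1g.
pose K := <<[set t; u]>>%G.
have Kt : t \in K by rewrite mem_gen ?set21.
have Ku : u \in K by rewrite mem_gen ?set22.
have Kw : w \in K by rewrite !groupM.
have /subsetP sub: K \subset [set 1; t * u; u * t] :|: [set t; u; w].
  apply: gen_subset_closed => [|a x /set2P[]->]; first by rewrite !inE eqxx.
    by rewrite !inE -!orbA => /or4P[|||/or3P[]] /eqP->;
      rewrite ?mulg1 ?mulgA ?tw ?tt ?mul1g ?eqxx ?orbT.
  rewrite !inE -!orbA => /or4P[|||/or3P[]] /eqP->;
  by rewrite ?mulg1 ?mulgA -?braid ?wt ?uw ?uu ?mul1g ?eqxx ?orbT.
have evenK v : v \in G -> p v * (p t)^-1 \in K ->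
    [\/ p v = p t, p v = t * u * p t | p v = u * t * p t].
  move=> Gv /sub; have := odd_quotient Gt Gv; set h := p v * _.
  have -> : p v = h * p t by rewrite mulgKV.
  move=> oh /setUP[]; rewrite !inE -!orbA => /or3P[] /eqP hE.
  - by constructor 1; rewrite hE mul1g.
  - by constructor 2; rewrite hE.
  - by constructor 3; rewrite hE.
  - by rewrite hE G_odd in oh.
  - by rewrite hE G_odd in oh.
  by rewrite hE G_odd in oh.
have GKw s h : s \in [set t; u; w] -> h \in K -> s ^ h \in G.
  move=> Ts Kh; suff: s ^ h \in [set t; u; w].
    by rewrite !inE -!orbA => /or3P[] /eqP->.
  rewrite memJ_norm //; apply: subsetP Kh; rewrite gen_subG.
  apply/subsetP=> a Aa; rewrite inE; apply/subsetP=> _ /imsetP[r Tr ->].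
  move: Tr Aa; rewrite !inE -!orbA => /or3P[] /eqP-> /orP[] /eqP->;
  by rewrite ?tJt ?uJu ?tJu ?uJt ?wJt ?wJu ?eqxx ?orbT.
have tu1 : t * u != 1.
  by apply: contra neq_tu => /eqP /(canRL (mulgK _)); rewrite mul1g uV => ->.
have ut1 : u * t != 1.
  by apply: contra neq_tu => /eqP /(canRL (mulgK _)); rewrite mul1g tV => ->.
have tuut : t * u != u * t.
  apply: contra tu1 => /eqP tu.
  by rewrite -uw /w tu -mulgA tt mulg1 uu.
have Jpt h s : h * p t = p (s ^ h^-1) -> s ^ h^-1 = t -> h = 1.
  by move=> hp E; move: hp; rewrite E -{2}[p t]mul1g => /mulIg.
have tuV : (t * u)^-1 = u * t by rewrite invMg tV uV.
have utV : (u * t)^-1 = t * u by rewrite invMg tV uV.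
case: (evenK _ Gu (precluded_edges_same_coset Gt Gu Kt Ku)) => pu.
- by rewrite /share_end pu eqxx.
- exfalso.
  (* The matching [h * p t -> h * u * p t] is met at [h = 1], [t * u] or [u * t], in colour [u], [w]
     or [t] respectively; only [w] is compatible with the known [p u] and [p t]. *)
  have pw : p w = t * u * p t.
    have [|v [Gv Kv]] := braid_meets Gt Kt Ku uu.
      by move=> h; apply: GKw; rewrite !inE eqxx orbT.
    case: (evenK v Gv Kv) => pv; rewrite pv ?mulgK ?mulgV => vE.
    + move: pu; rewrite -pv vE invg1 conjg1 -{1}[p u]mul1g => /mulIg /esym /eqP.
      by rewrite (negPf tu1).
    + by rewrite -pv vE tuV conjgM uJu uJt.
    by case/eqP: ut1; apply: (@Jpt _ u); rewrite -?vE // vE utV conjgM uJt wJu.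
  (* The matching of [w] is now met nowhere: at [h = 1], [t * u], [u * t] the colour would be [w],
     [t], [u], and each of these has its even end elsewhere. *)
  have [|v [Gv Kv]] := braid_meets Gt Kt Kw ww.
    by move=> h; apply: GKw; rewrite !inE eqxx orbT.
  case: (evenK v Gv Kv) => pv; rewrite pv ?mulgK ?mulgV => vE.
  + move: pw; rewrite -pv vE invg1 conjg1 -{1}[p w]mul1g => /mulIg /esym /eqP.
    by rewrite (negPf tu1).
  + by case/eqP: tu1; apply: (@Jpt _ w); rewrite -?vE // vE tuV conjgM wJu tJt.
  by case/eqP: tuut; apply: (mulIg (p t)); rewrite -pu -pv vE utV conjgM wJt uJu.
by rewrite /share_end pu !mulgA uu mul1g eqxx orbT.
Qed.

(** * From pairwise shared ends to a star *)

Definition edge_end (b : bool) t := if b then p t else t * p t.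

Lemma share_endP t u :
  reflect (exists b, edge_end b t = edge_end b u) (share_end t u).
Proof.
apply: (iffP orP) => [[] /eqP | [[] /eqP]]; by [exists true | exists false | left | right].
Qed.

Lemma edge_end_inj b t u :
  edge_end b t = edge_end b u -> edge_end (~~ b) t = edge_end (~~ b) u -> t = u.
Proof. by case: b; [move=> /= -> /mulIg | move=> /[swap] /= -> /mulIg]. Qed.

(** There are three pairs but two kinds of end, so two pairs share an end of the same kind; these
    pairs have an edge in common, which links all three. *)
Lemma pairwise_share_end t u w :
  share_end t u -> share_end u w -> share_end t w ->
  exists b, edge_end b t = edge_end b u /\ edge_end b u = edge_end b w.
Proof.
move=> /share_endP[b1 tu] /share_endP[b2 uw] /share_endP[b3 tw].
have [b12 | b12] := eqVneq b1 b2; first by exists b1; split=> //; rewrite b12.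
have [b13 | b13] := eqVneq b1 b3.
  by exists b1; split=> //; rewrite -tu b13.
have b23 : b2 = b3 by case: b1 b2 b3 b12 b13 {tu uw tw} => [] [] [].
by exists b2; split=> //; rewrite uw b23 tw.
Qed.

(** Each transposition of a triangle conjugates the second into the third, which is the braid
    relation. *)
Lemma tperm_share_end (x y z : 'I_n) :
  x != y -> x != z -> y != z ->
  tperm x y \in G -> tperm x z \in G -> tperm y z \in G ->
  share_end (tperm x y) (tperm x z).
Proof.
move=> xy xz yz Gxy Gxz Gyz.
have conj (a b c : 'I_n) : a != b -> a != c -> b != c ->
    tperm a b * tperm a c * tperm a b = tperm b c.
  move=> ab ac bc; rewrite -mulgA -{1}[tperm a b]tpermV -conjgE tpermJ tpermL.
  by rewrite tpermD // eq_sym.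
apply: braid_share_end; rewrite // ?conj // 1?[z == y]eq_sym // 1?[tperm z y]tpermC //.
apply: contra yz => /eqP E; have := tpermL x y.
by rewrite E tpermL => ->.
Qed.

(** Indexing by [nat] allows an induction along the fan. At [j = 1] spoke and rim coincide, so the
    rim hypothesis starts at 2. *)
Lemma fan_common_end (pos : nat -> 'I_n) :
  {in gtn n &, injective pos} ->
  (forall j, 0 < j < n -> tperm (pos 0) (pos j) \in G) ->
  (forall j, 1 < j < n -> tperm (pos j.-1) (pos j) \in G) ->
  exists c x, forall j, 0 < j < n ->
    edge_end c (tperm (pos 0) (pos j)) = x /\
    edge_end c (tperm (pos j.-1) (pos j)) = x.
Proof.
move=> pos_inj; set a := fun j => tperm (pos 0) (pos j).
set b := fun j => tperm (pos j.-1) (pos j) => Ga Gb.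
have pos_neq i j : i < j < n -> pos i != pos j.
  case/andP=> ij jn; apply/eqP => /pos_inj E; move: (ij).
  by rewrite E ?ltnn // inE (ltn_trans ij).
have triangle j : 0 < j -> j.+1 < n ->
    exists c, edge_end c (a j) = edge_end c (a j.+1) /\
              edge_end c (a j.+1) = edge_end c (b j.+1).
  move=> j0 jn; have jn' := ltnW jn.
  have n0 : pos 0 != pos j by rewrite pos_neq ?j0.
  have n1 : pos 0 != pos j.+1 by rewrite pos_neq.
  have n2 : pos j != pos j.+1 by rewrite pos_neq ?ltnSn.
  have G0 : tperm (pos 0) (pos j) \in G by rewrite Ga ?j0.
  have G1 : tperm (pos 0) (pos j.+1) \in G by rewrite Ga.
  have G2 : tperm (pos j) (pos j.+1) \in G by rewrite (Gb j.+1) // ltnS j0.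
  apply: pairwise_share_end; rewrite /a /b /=.
  - exact: tperm_share_end.
  - rewrite tpermC [tperm (pos j) _]tpermC.
    by apply: tperm_share_end; rewrite 1?eq_sym // 1?tpermC // eq_sym.
  - rewrite tpermC.
    by apply: tperm_share_end; rewrite 1?eq_sym // 1?tpermC // eq_sym.
suff chain k : k.+1 < n -> exists c, forall j, 0 < j <= k.+1 ->
    edge_end c (a j) = edge_end c (a 1%N) /\ edge_end c (b j) = edge_end c (a 1%N).
  have [|c cP] := chain n.-2; first by rewrite -subn2 -subSn // subn2 /= prednK // ltnW.
  exists c, (edge_end c (a 1%N)) => j /andP[j0 jn]; apply: cP; rewrite j0.
  by rewrite -subn2 -subSn // subn2 /= -ltnS prednK // ltnW.
elim: k => [|[|k] IHk] kn.
(* [a 1] and [b 1] are the same transposition, so either kind of end would do. *)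
- by exists true => j /andP[j0 j1]; have -> : j = 1%N by apply/eqP; rewrite eqn_leq j1.
- have [//|//|c [c1 c2]] := triangle 1%N.
  exists c => -[|[|[|j]]] //= _.
  by rewrite -c2 -c1.
have [|c cP] := IHk; first exact: ltnW.
have [//|//|c' [c1 c2]] := triangle k.+2.
have [|ak _] := cP k.+2; first by rewrite leqnn.
have [|ak1 _] := cP k.+1; first by rewrite leqnSn.
have [cc' | neq_c] := eqVneq c' c.
  exists c => j /andP[j0]; rewrite leq_eqVlt => /orP[/eqP-> | jk].
    by rewrite -ak -cc' -c2 -c1.
  by apply: cP; rewrite j0.
have c'E : c' = ~~ c by case: c c' neq_c {cP c1 c2 ak ak1} => [] [].
rewrite c'E in c1 c2.
have lt_k : k.+2 < n := ltnW kn.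
(* These transpositions are disjoint, hence commute. If the new triangle had its centre at the other
   kind of end, then for either value of [d] the edge of [a k.+2] would share both ends with that of
   [b k.+3] or [a k.+1], forcing equal colours. *)
have/share_endP[d dE] : share_end (a k.+1) (b k.+3).
  apply: commuting_share_end; rewrite ?Ga ?Gb //=; first exact: ltnW.
  rewrite /commute /a /b /= (conjgC (tperm (pos 0) _)) tpermJ.
  by rewrite !tpermD // 1?eq_sym // pos_neq //= ?ltnSn ?ltnS ?leqnSn ?lt_k.
exfalso; have [dc | neq_d] := eqVneq d c.
  have : a k.+2 = b k.+3.
    by apply: (@edge_end_inj c); [rewrite ak -ak1 -dc | rewrite c1].
  move/(congr1 (fun s : 'S_n => s (pos 0))); rewrite /a /b /= tpermL.
  rewrite tpermD; [move/eqP; rewrite eq_sym; apply/negP | rewrite eq_sym | rewrite eq_sym];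
    by rewrite pos_neq.
have dE' : d = ~~ c by case: c d neq_d {cP c1 c2 ak ak1 dE neq_c c'E} => [] [].
have : a k.+1 = a k.+2.
  apply: (@edge_end_inj c); first by rewrite ak ak1.
  by rewrite c1 c2 -dE'.
move/(congr1 (fun s : 'S_n => s (pos 0))); rewrite /a !tpermL; move/eqP; apply/negP.
by rewrite pos_neq ?ltnSn.
Qed.

End CayleyPreclusion.

(** * Application to the bubble-sort star graph *)

Theorem theorem3p6 (n : nat) (F : {set {set 'S_n}}) :
  3 <= n ->
  optimal_preclusion_set (@bubble_sort_star n) F ->
  trivial_edge_set F.
Proof.
case: n F => [|n] // F n_ge3 optF.
pose adj (i j : 'I_n.+1) :=
  ((i == 0 :> nat) && (1 <= j)) || ((i.+1 == j :> nat) && (2 <= j)).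
pose G := [set tperm q.1 q.2 | q : 'I_n.+1 * 'I_n.+1 & adj q.1 q.2].
have GP i j : adj i j -> tperm i j \in G.
  by move=> ij; apply/imsetP; exists (i, j); rewrite ?inE.
have eG u v : bubble_sort_star u v = (u * v^-1 \in G).
  apply/existsP/imsetP => [[i /existsP[j /andP[ij /eqP->]]] | [[i j]]].
    by exists (i, j); rewrite ?inE // mulgK.
  rewrite inE => ij E; exists i; apply/existsP; exists j.
  by apply/andP; split=> //; rewrite /swap_entries -E mulgKV.
have G_inv t : t \in G -> t * t = 1 by case/imsetP=> q _ ->; apply: tperm2.
have G_odd t : t \in G -> odd_perm t.
  case/imsetP=> [[i j]]; rewrite inE /= => ij ->.
  rewrite odd_tperm; apply: contraTneq ij => ->.
  by rewrite /adj lt0n andbN (gtn_eqF (ltnSn j)).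
have n_gt1 : 1 < n.+1 by apply: ltnW.
have [p [p_even -> p_meets]] := optimal_cayley_edges n_gt1 eG G_odd G_inv optF.
have [||| c [x cP]] :=
  fan_common_end n_gt1 G_odd G_inv p_even p_meets (pos := @inord n).
- by move=> i j; rewrite !inE => lin ljn /(congr1 val); rewrite /= !inordK.
- move=> j /andP[j0 jn]; apply: GP.
  by rewrite /adj !inordK // j0.
- move=> j /andP[j1 jn]; apply: GP; have j0 := ltnW j1.
  rewrite /adj !inordK ?prednK // ?eqxx ?j1 ?orbT //.
  by rewrite (leq_trans _ jn).
apply/existsP; exists x; apply/forall_inP => _ /imsetP[_ /imsetP[[i j] ij ->] ->].
rewrite inE /= in ij *.
suff: edge_end p c (tperm i j) = x.
  by case: (c) => <-; rewrite ?set21 ?set22.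
(* The first kind of generator is a spoke of the fan, the second a rim edge. *)
case/orP: ij => /andP[/eqP i0 j0].
  have [|<- _] := cP j; first by rewrite j0 ltn_ord.
  by rewrite -i0 !inord_val.
have [|_ <-] := cP j; first by rewrite (ltnW j0) ltn_ord.
by rewrite -i0 /= i0 !inord_val.
Qed.
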